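(* Let $N\ge2$, $U=-e^{2\pi i/N}\begin{pmatrix}1/2&-\sqrt{3}/2\\ \sqrt3/2&1/2\end{pmatrix}$, and $|\psi_i\rangle=(U^i|0\rangle)^{\otimes N}$ for $i=0,1,2$, each with prior $1/3$, shared among $N$ parties each holding one qubit. Then no $N$-party LOCC measurement attains the optimal minimum-error success probability for this ensemble.
   Context: The optimal minimum-error success probability of an ensemble $\{|\psi_i\rangle,p_i\}_{i=0}^2$ is the maximum over all three-outcome POVMs $\{\Pi_i\}$ on $(\mathbb{C}^2)^{\otimes N}$ of $\sum_ip_i\langle\psi_i|\Pi_i|\psi_i\rangle$. $N$-party LOCC means measurements implementable by local operations on each party's qubit together with classical communication among the parties. *)

(* Defs.v *)
From HB Require Import structures.
From mathcomp Require Import all_boot all_order all_algebra all_field.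
Set Implicit Arguments. Unset Strict Implicit. Unset Printing Implicit Defensive.
Import Order.TTheory GRing.Theory Num.Theory.
Local Open Scope ring_scope.

Section Defs.
Variables (C : numClosedFieldType) (N : nat).

(* computational basis labels of (C^2)^{\otimes N}: bit strings s : 'I_N -> 'I_2 *)
Definition basis := {ffun 'I_N -> 'I_2}.
Definition vec := basis -> C.
Definition op := basis -> basis -> C.

(* omega = e^{2 pi i / N} : N.-root (-1) is e^{i pi / N} (minimal nonnegative argument) *)
Definition omega : C := (N.-root (-1)) ^+ 2.

Definition Umat : 'M[C]_2 :=
  - omega *: \matrix_(a < 2, b < 2)
     (if (a == 0) && (b == 0) then 2^-1
      else if (a == 0) then - (sqrtC 3 / 2)
      else if (b == 0) then sqrtC 3 / 2 else 2^-1).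

Definition ket0 : 'cV[C]_2 := \col_(a < 2) (if a == 0 then 1 else 0).

Definition psi (i : 'I_3) : vec :=
  fun s => \prod_(k < N) ((Umat ^+ i *m ket0) (s k) 0).

Definition inner_op (v : vec) (A : op) (w : vec) : C :=
  \sum_(s : basis) \sum_(t : basis) (v s)^* * A s t * w t.

Definition psd (A : op) : Prop := forall x : vec, 0 <= inner_op x A x.

Definition povm (Pi : 'I_3 -> op) : Prop :=
  (forall i, psd (Pi i)) /\
  forall s t, \sum_(i < 3) Pi i s t = (if s == t then 1 else 0).

Definition success (Pi : 'I_3 -> op) : C :=
  \sum_(i < 3) 3^-1 * inner_op (psi i) (Pi i) (psi i).

(* Protocol tree: at each node a party k applies a local instrument given by
   Kraus operators K_0..K_{m-1} on its qubit; the outcome is broadcast and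
   determines the rest of the protocol; leaves carry the final guess. *)
Inductive protocol : Type :=
| Leaf of 'I_3
| Node (k : 'I_N) (m : nat) (K : 'I_m -> 'M[C]_2) (next : 'I_m -> protocol).

Definition adjmx (A : 'M[C]_2) : 'M[C]_2 := (map_mx Num.conj A)^T.

Fixpoint valid (p : protocol) : Prop :=
  match p with
  | Leaf _ => True
  | Node k m K next =>
      \sum_(j < m) adjmx (K j) *m K j = 1 /\ forall j, valid (next j)
  end.

Definition set_bit (s : basis) (k : 'I_N) (b : 'I_2) : basis :=
  [ffun j => if j == k then b else s j].

Definition act (k : 'I_N) (A : 'M[C]_2) (v : vec) : vec :=
  fun s => \sum_(b < 2) A (s k) b * v (set_bit s k b).

Definition normsq (v : vec) : C := \sum_(s : basis) `|v s| ^+ 2.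

(* probability (for unnormalized post-measurement vector v) that the
   protocol outputs guess i *)
Fixpoint prob (p : protocol) (v : vec) (i : 'I_3) : C :=
  match p with
  | Leaf l => if l == i then normsq v else 0
  | Node k m K next => \sum_(j < m) prob (next j) (act k (K j) v) i
  end.

Definition locc_success (p : protocol) : C :=
  \sum_(i < 3) 3^-1 * prob p (psi i) i.

End Defs.

(* Main.v *)
Require Import Defs.
From HB Require Import structures.
From mathcomp Require Import all_boot all_order all_algebra all_field.
From mathcomp Require Import ring.
Set Implicit Arguments. Unset Strict Implicit. Unset Printing Implicit Defensive.
Import Order.TTheory GRing.Theory Num.Theory.
Local Open Scope ring_scope.

(* As omega^N = 1, psi_i is the N-fold power of the i-th trine vector, so that
   the Gram matrix of the ensemble has entries 1 and g = (-1/2)^N. Let a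
   (diagonal) and b (off-diagonal) be the entries of its square root, and phi
   the orthonormal basis with psi_i = a phi_i + b \sum_(j != i) phi_j; measuring
   in this basis succeeds with probability a^2. By duality no protocol does
   better, and if one attains a^2 then the product Kraus operator A reached at
   any of its nodes keeps the vectors A phi_i pairwise orthogonal. Consider a
   node at which all parties' operators are still multiples of isometries: the
   orthogonality after its local measurement is a linear condition on the local
   Gram matrix of the trine vectors which, since b != 0, forces it to stay
   proportional to the original one. So every measurement of the protocol is
   trivial down to some leaf, where the answer cannot be optimal. *)

(** * The sesquilinear form on functions over a finite type *)

Section InnerProduct.
Variables (C : numClosedFieldType) (T : finType).
Implicit Types v w : T -> C.

Definition dot v w : C := \sum_s (v s)^* * w s.

Lemma eq_dot v v' w w' : v =1 v' -> w =1 w' -> dot v w = dot v' w'.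
Proof. by move=> ev ew; apply: eq_bigr => s _; rewrite ev ew. Qed.

Lemma dot_ge0 v : 0 <= dot v v.
Proof. by apply: sumr_ge0 => s _; rewrite mulrC mul_conjC_ge0. Qed.

Lemma dot_eq0 v : dot v v = 0 -> v =1 fun=> 0.
Proof.
move=> v0 s; apply/eqP; rewrite -mul_conjC_eq0 mulrC; apply/eqP.
by apply: (psumr_eq0P _ v0) => // t _; rewrite mulrC mul_conjC_ge0.
Qed.

Lemma conj_dot v w : (dot v w)^* = dot w v.
Proof. by rewrite rmorph_sum; apply: eq_bigr => s _; rewrite rmorphM /= conjCK mulrC. Qed.

Lemma dot_sumr (I : finType) (c : I -> C) (f : I -> T -> C) v :
  dot v (fun s => \sum_i c i * f i s) = \sum_i c i * dot v (f i).
Proof.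
rewrite /dot; under eq_bigr do rewrite mulr_sumr.
rewrite exchange_big; apply: eq_bigr => i _; rewrite mulr_sumr.
by apply: eq_bigr => s _; rewrite mulrCA.
Qed.

Lemma dot_suml (I : finType) (c : I -> C) (f : I -> T -> C) v :
  dot (fun s => \sum_i c i * f i s) v = \sum_i (c i)^* * dot (f i) v.
Proof.
rewrite -conj_dot dot_sumr rmorph_sum; apply: eq_bigr => i _.
by rewrite rmorphM /= conj_dot.
Qed.

Lemma dotDD v w :
  dot (fun s => v s + w s) (fun s => v s + w s) =
  dot v v + dot w w + (dot v w + dot w v).
Proof.
rewrite /dot -!big_split; apply: eq_bigr => s _ /=.
by rewrite rmorphD /=; ring.
Qed.

Lemma dotBB v w :
  dot (fun s => v s - w s) (fun s => v s - w s) =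
  dot v v + dot w w - (dot v w + dot w v).
Proof.
rewrite /dot -!big_split -sumrB; apply: eq_bigr => s _ /=.
by rewrite rmorphB /=; ring.
Qed.

End InnerProduct.

(** * Operators on a single qubit *)

Section Local.
Variable C : numClosedFieldType.

Definition mulv (A : 'M[C]_2) (v : 'I_2 -> C) : 'I_2 -> C :=
  fun c => \sum_b A c b * v b.

Lemma dot_mulv (A : 'M[C]_2) (v w : 'I_2 -> C) :
  dot (mulv A v) (mulv A w) =
  \sum_a \sum_b (v a)^* * (adjmx A *m A) a b * w b.
Proof.
transitivity (\sum_c \sum_a \sum_b (v a)^* * ((A c a)^* * A c b) * w b).
  apply: eq_bigr => c _; rewrite rmorph_sum mulr_suml; apply: eq_bigr => a _.
  by rewrite mulr_sumr; apply: eq_bigr => b _; rewrite rmorphM /=; ring.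
rewrite exchange_big; apply: eq_bigr => a _; rewrite exchange_big.
apply: eq_bigr => b _; rewrite -mulr_suml -mulr_sumr mxE.
by congr (_ * _ * _); apply: eq_bigr => c _; rewrite !mxE.
Qed.

Lemma sum_dot_mulv m (K : 'I_m -> 'M[C]_2) (v w : 'I_2 -> C) :
  \sum_j adjmx (K j) *m K j = 1 ->
  \sum_j dot (mulv (K j) v) (mulv (K j) w) = dot v w.
Proof.
move=> K1; under eq_bigr do rewrite dot_mulv.
rewrite exchange_big; apply: eq_bigr => a _; rewrite exchange_big /=.
under eq_bigr do rewrite -mulr_suml -mulr_sumr -summxE K1 mxE.
rewrite (bigD1 a) //= eqxx mulr1 big1 ?addr0 // => b /negPf ba.
by rewrite eq_sym ba mulr0 mul0r.
Qed.

End Local.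

(** * Local operators and product vectors on [N] qubits *)

Section Party.
Variables (C : numClosedFieldType) (N : nat).
Implicit Types (v w : vec C N) (k : 'I_N).

(** Strings with bit [k] equal to 0 label the configurations of the other parties; the inner sum
    then runs over one qubit, where [act k] is just [mulv]. *)
Lemma sum_basis k (F : basis N -> C) :
  \sum_s F s = \sum_(s : basis N | s k == 0) \sum_(c < 2) F (set_bit s k c).
Proof.
rewrite [RHS]exchange_big [LHS](partition_big (fun s : basis N => s k) xpredT) //=.
apply: eq_bigr => c _.
rewrite (reindex_onto (fun s => set_bit s k c) (fun s => set_bit s k 0)).
  apply: eq_bigl => s; rewrite ffunE eqxx eqxx /=; apply/eqP/eqP => [<-|s0].
    by rewrite !ffunE eqxx.
  by apply/ffunP => l; rewrite !ffunE; case: eqP => [->|//].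
move=> s /eqP sk; apply/ffunP => l; rewrite !ffunE.
by case: eqP => [->|//].
Qed.

Lemma act_set_bit k (A : 'M[C]_2) v s c :
  act k A v (set_bit s k c) = mulv A (fun b => v (set_bit s k b)) c.
Proof.
rewrite /act ffunE eqxx; apply: eq_bigr => b _; congr (_ * v _).
by apply/ffunP => l; rewrite !ffunE; case: eqP.
Qed.

Lemma eq_act k (A : 'M[C]_2) v w : v =1 w -> act k A v =1 act k A w.
Proof. by move=> vw s; apply: eq_bigr => b _; rewrite vw. Qed.

Lemma act_sum (I : finType) k (A : 'M[C]_2) (c : I -> C) (f : I -> vec C N) :
  act k A (fun s => \sum_i c i * f i s) =1 fun s => \sum_i c i * act k A (f i) s.
Proof.
move=> s; rewrite /act; under eq_bigr do rewrite mulr_sumr.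
rewrite exchange_big; apply: eq_bigr => i _; rewrite mulr_sumr.
by apply: eq_bigr => b _; rewrite mulrCA.
Qed.

Lemma eq_prob (p : protocol C N) v w i : v =1 w -> prob p v i = prob p w i.
Proof.
elim: p v w => [l|k m K next IH] v w vw /=.
  by case: eqP => // _; apply: eq_bigr => s _; rewrite vw.
by apply: eq_bigr => j _; apply/IH/eq_act.
Qed.

Lemma normsqE v : normsq v = dot v v.
Proof. by apply: eq_bigr => s _; rewrite normCK mulrC. Qed.

Definition tensor (x : 'I_N -> 'I_2 -> C) : vec C N :=
  fun s => \prod_k x k (s k).

Lemma dot_tensor (x y : 'I_N -> 'I_2 -> C) :
  dot (tensor x) (tensor y) = \prod_k dot (x k) (y k).
Proof.
rewrite /dot bigA_distr_bigA; apply: eq_bigr => s _.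
by rewrite rmorph_prod -big_split.
Qed.

Lemma act_tensor k (A : 'M[C]_2) (x : 'I_N -> 'I_2 -> C) :
  act k A (tensor x) =1 tensor (fun l => if l == k then mulv A (x k) else x l).
Proof.
move=> s; rewrite /act /tensor (bigD1 k) //= eqxx mulr_suml.
apply: eq_bigr => b _; rewrite (bigD1 k) //= ffunE eqxx mulrA; congr (_ * _).
by apply: eq_bigr => l /negPf lk; rewrite ffunE lk.
Qed.

(** Completeness of the Kraus operators, used on each fibre of qubit [k]. It makes Gram matrices add
    up over the outcomes of a node. *)
Lemma sum_dot_act m (k : 'I_N) (K : 'I_m -> 'M[C]_2) v w :
  \sum_j adjmx (K j) *m K j = 1 ->
  \sum_j dot (act k (K j) v) (act k (K j) w) = dot v w.
Proof.
move=> K1; rewrite [RHS](sum_basis k); under eq_bigr do rewrite [dot _ _](sum_basis k).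
rewrite exchange_big; apply: eq_bigr => s _.
rewrite -[RHS](sum_dot_mulv (fun c => v (set_bit s k c))
  (fun c => w (set_bit s k c)) K1).
by apply: eq_bigr => j _; apply: eq_bigr => c _; rewrite !act_set_bit.
Qed.

End Party.

(** * Case analysis on three indices *)

Lemma ord3_neq (i : 'I_3) : exists j, i != j.
Proof. by exists (i + 1); case: i => [[|[|[|]]]]. Qed.

Lemma ord3_sum (R : nmodType) (i j : 'I_3) : i != j ->
  exists k, [/\ k != i, k != j &
    forall F : 'I_3 -> R, \sum_l F l = F i + F j + F k].
Proof.
move=> ij; have [k /andP[ki kj]] : exists k, (k != i) && (k != j).
  apply/existsP; move: i j ij.
  by do 2![case=> [[|[|[|//]]] ?]] => // _; apply/existsP;
    [exists (inord 2)|exists (inord 1)|exists (inord 2)|exists 0|exists (inord 1)|exists 0];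
    rewrite -!val_eqE /= ?inordK.
exists k; split=> // F; rewrite (bigD1 i) //= (bigD1 j) 1?eq_sym //=.
rewrite (big_pred1 k) ?addrA // => l /=.
move: i j k l ij ki kj {F}.
by do 4![case=> [[|[|[|//]]] ?]].
Qed.

(** * Duality for the minimum-error problem *)

Section Comb.
Variables (C : numClosedFieldType) (a b : C).

(* The square root of the Gram matrix of the three states: the latter is
   circulant with constant off-diagonal entries, hence so is its root. *)
Definition sm (i j : 'I_3) : C := if i == j then a else b.

Definition comb (T : Type) (f : 'I_3 -> T -> C) (i : 'I_3) : T -> C :=
  fun s => \sum_j sm i j * f j s.

(* The trace of A^* A against the dual optimal operator of the minimum-error
   problem, for an operator A mapping the optimal basis to the vectors f i. *)
Definition lagrange (T : finType) (f : 'I_3 -> T -> C) : C :=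
  a * \sum_i \sum_j sm i j * dot (f i) (f j).

Variable T : finType.
Implicit Type f : 'I_3 -> T -> C.

Hypotheses (a_real : a^* = a) (b_real : b^* = b).

Lemma conj_sm i j : (sm i j)^* = sm i j.
Proof. by rewrite /sm; case: ifP. Qed.

Lemma dot_comb f i j :
  dot (comb f i) (comb f j) = \sum_k \sum_l sm i k * sm j l * dot (f k) (f l).
Proof.
rewrite dot_suml; apply: eq_bigr => k _; rewrite dot_sumr conj_sm mulr_sumr.
by apply: eq_bigr => l _; rewrite mulrA.
Qed.

Lemma dot_comb_orth f i j : (forall k l, k != l -> dot (f k) (f l) = 0) ->
  dot (comb f i) (comb f j) = \sum_k sm i k * sm j k * dot (f k) (f k).
Proof.
move=> f0; rewrite dot_comb; apply: eq_bigr => k _; rewrite (bigD1 k) //= big1 ?addr0 //.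
by move=> l lk; rewrite f0 1?eq_sym // mulr0.
Qed.

(** For the basis [phi], the dual operator minus the projector on [psi i] kills [phi i] and has
    eigenvectors [phi j + phi k] and [phi j - phi k], with eigenvalues [(a - b) * (a + b *+ 2)] and
    [(a - b) * a]. *)
Lemma lagrange_deficit f i j k : i != j -> k != i -> k != j ->
  (forall F : 'I_3 -> C, \sum_l F l = F i + F j + F k) ->
  lagrange f - dot (comb f i) (comb f i) =
  (a - b) / 2 *
   ((a + b *+ 2) * dot (fun s => f j s + f k s) (fun s => f j s + f k s) +
    a * dot (fun s => f j s - f k s) (fun s => f j s - f k s)).
Proof.
move=> ij ki kj S; rewrite dot_comb /lagrange !S /sm !eqxx.
rewrite [j == i]eq_sym [i == k]eq_sym [j == k]eq_sym.
rewrite (negPf ij) (negPf ki) (negPf kj).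
rewrite dotDD dotBB.
by field.
Qed.

Hypotheses (a_gt0 : 0 < a) (ab_gt0 : 0 < a - b) (a2b_gt0 : 0 < a + b *+ 2).

Lemma lagrange_ge f i : dot (comb f i) (comb f i) <= lagrange f.
Proof.
have [j ij] := ord3_neq i.
have [k [ki kj S]] := ord3_sum C ij.
rewrite -subr_ge0 (lagrange_deficit f ij ki kj S).
have a0 := ltW a_gt0; have ab0 := ltW ab_gt0; have a2b0 := ltW a2b_gt0.
by apply: mulr_ge0; [by rewrite divr_ge0 ?ler0n|apply: addr_ge0; apply: mulr_ge0];
   rewrite ?dot_ge0.
Qed.

(** Complementary slackness: both squared norms in the deficit must vanish. *)
Lemma lagrange_eq f i : dot (comb f i) (comb f i) = lagrange f ->
  forall j, j != i -> f j =1 fun=> 0.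
Proof.
move=> eqf j ji; have ij : i != j by rewrite eq_sym.
have [k [ki kj S]] := ord3_sum C ij.
have := lagrange_deficit f ij ki kj S; rewrite eqf subrr => /esym/eqP.
rewrite mulf_eq0 gt_eqF ?divr_gt0 //=.
rewrite paddr_eq0 ?(mulr_ge0 (ltW _) (dot_ge0 _)) //.
rewrite !mulf_eq0 (gt_eqF a_gt0) (gt_eqF a2b_gt0) => /andP[/eqP/dot_eq0 p0 /eqP/dot_eq0 m0] s.
have: f j s *+ 2 = 0.
  transitivity ((f j s + f k s) + (f j s - f k s)); first by ring.
  by rewrite p0 m0 addr0.
by move/eqP; rewrite mulrn_eq0 => /eqP.
Qed.

End Comb.

(** * Protocols against the dual bound *)

Section Protocol.
Variables (C : numClosedFieldType) (N : nat) (a b : C).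
Implicit Types (p : protocol C N) (f : 'I_3 -> vec C N).
Hypotheses (a_real : a^* = a) (b_real : b^* = b).
Hypotheses (a_gt0 : 0 < a) (ab_gt0 : 0 < a - b) (a2b_gt0 : 0 < a + b *+ 2).

(** Three times the success probability if [comb a b f] is the ensemble. Being expressed through
    [f], it can be followed down the tree together with [lagrange]. *)
Definition guess p f : C := \sum_i prob p (comb a b f i) i.

Lemma guess_leaf l f :
  guess (Leaf C N l) f = dot (comb a b f l) (comb a b f l).
Proof.
rewrite /guess (bigD1 l) //= eqxx normsqE big1 ?addr0 // => i /negPf il.
by rewrite eq_sym il.
Qed.

Lemma guess_node (k : 'I_N) m (K : 'I_m -> 'M[C]_2) next f :
  guess (Node k K next) f =
  \sum_j guess (next j) (fun i => act k (K j) (f i)).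
Proof.
rewrite [RHS]exchange_big; apply: eq_bigr => i _; apply: eq_bigr => j _.
exact/eq_prob/act_sum.
Qed.

Lemma lagrange_node (k : 'I_N) m (K : 'I_m -> 'M[C]_2) f :
  \sum_j adjmx (K j) *m K j = 1 ->
  \sum_j lagrange a b (fun i => act k (K j) (f i)) = lagrange a b f.
Proof.
move=> K1; rewrite -mulr_sumr exchange_big; congr (_ * _); apply: eq_bigr => i _.
rewrite exchange_big; apply: eq_bigr => l _ /=.
by rewrite -mulr_sumr sum_dot_act.
Qed.

(** Weak duality: both sides add up over the outcomes of a node, and a leaf is the dual constraint
    itself. *)
Lemma guess_le p f : valid p -> guess p f <= lagrange a b f.
Proof.
elim: p f => [l|k m K next IH] f /=; first by rewrite guess_leaf lagrange_ge.
case=> K1 vnext; rewrite guess_node -(lagrange_node k f K1).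
by apply: ler_sum => j _; apply: IH.
Qed.

Lemma guess_node_eq (k : 'I_N) m (K : 'I_m -> 'M[C]_2) next f :
  valid (Node k K next) -> guess (Node k K next) f = lagrange a b f ->
  forall j, guess (next j) (fun i => act k (K j) (f i)) =
            lagrange a b (fun i => act k (K j) (f i)).
Proof.
case=> K1 vnext; rewrite guess_node -(lagrange_node k f K1) => eqf j.
apply/esym/subr0_eq.
apply: (psumr_eq0P (P := xpredT) (F := fun j => lagrange a b
  (fun i => act k (K j) (f i)) - guess (next j) (fun i => act k (K j) (f i)))) => //.
  by move=> r _; rewrite subr_ge0; apply/guess_le/vnext.
by rewrite sumrB eqf subrr.
Qed.

(* At a leaf answering l only f l survives, and the Gram matrix of f is the sum
   of the Gram matrices at the leaves, so it is diagonal. *)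
Lemma guess_eq_orth p f : valid p -> guess p f = lagrange a b f ->
  forall i j, i != j -> dot (f i) (f j) = 0.
Proof.
elim: p f => [l|k m K next IH] f vp eqf i j ij.
  have f0 : forall i, i != l -> f i =1 fun=> 0.
    by apply: (lagrange_eq a_real b_real a_gt0) => //; rewrite -guess_leaf.
  rewrite /dot; have [il|il] := eqVneq i l; apply: big1 => s _.
    by rewrite (f0 j) ?mulr0 // -il eq_sym.
  by rewrite (f0 i) // conjC0 mul0r.
have [K1 vnext] := vp.
rewrite -(sum_dot_act k (f i) (f j) K1) big1 // => r _.
exact: (IH r _ (vnext r) (guess_node_eq vp eqf r)).
Qed.

End Protocol.

(** * Rigidity of the local Gram matrix *)

Section Rigidity.
Variables (C : numClosedFieldType) (a b : C).

Definition trine_gram (i j : 'I_3) : C := if i == j then 1 else - 2^-1.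

Hypotheses (a_gt0 : 0 < a) (ab_gt0 : 0 < a - b) (a2b_gt0 : 0 < a + b *+ 2).
Hypotheses (b_neq0 : b != 0) (ab1 : a ^+ 2 + b ^+ 2 *+ 2 = 1).
Let g := a * b *+ 2 + b ^+ 2.

(* T is the local Gram matrix after one party has measured, c and - 2 g c
   are what the other parties contribute to its diagonal and off-diagonal. *)
Lemma gram_rigidity (T : 'I_3 -> 'I_3 -> C) (D : 'I_3 -> C) (c : C) :
  c != 0 ->
  (forall i, \sum_j T i j = 0) ->
  (forall i, T i i * c = \sum_k sm a b i k * sm a b i k * D k) ->
  (forall i j, i != j ->
     T i j * (c * (- g *+ 2)) = \sum_k sm a b i k * sm a b j k * D k) ->
  forall i j, T i j = T 0 0 * trine_gram i j.
Proof.
move=> c0 T0 Td To.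
have g0 : g != 0.
  have -> : g = b * ((a - b) + (a + b *+ 2)) by rewrite /g; ring.
  by rewrite mulf_neq0 // gt_eqF // addr_gt0.
have Dij i j : i != j -> D i = D j.
  move=> ij; have [k [ki kj S]] := ord3_sum C ij.
  have ik : i != k by rewrite eq_sym.
  have jk : j != k by rewrite eq_sym.
  have ji : j != i by rewrite eq_sym.
  have := T0 i; have := T0 j; have := To i j ij; have := To i k ik.
  have := To j i ji; have := To j k jk; have := Td i; have := Td j.
  rewrite !S /sm !eqxx (negPf ij) (negPf ik) (negPf ji) (negPf jk) (negPf ki) (negPf kj).
  move=> Mjj Mii Mjk Mji Mik Mij Tj Ti.
  (* The vanishing row sums, scaled by [- 2 g c] so that every term can be replaced through [Td] or
     [To]; this leaves linear equations in [D]. *)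
  have Ei : 0 = - g *+ 2 * (T i i * c) + T i j * (c * (- g *+ 2)) +
                T i k * (c * (- g *+ 2)).
    by rewrite -[LHS](mulr0 (- g *+ 2 * c)) -Ti; ring.
  have Ej : 0 = - g *+ 2 * (T j j * c) + T j i * (c * (- g *+ 2)) +
                T j k * (c * (- g *+ 2)).
    by rewrite -[LHS](mulr0 (- g *+ 2 * c)) -Tj; ring.
  (* [- 2 g (a + b) + b = - 3 a b (a + 2 b)] because [a^2 + 2 b^2 = 1] *)
  have key : b * a * (a + b *+ 2) * (a - b) *+ 3 * (D i - D j) = 0.
    transitivity ((b * (D i - D j) * (a - b)) * (1 - (a ^+ 2 + b ^+ 2 *+ 2))).
      rewrite -[LHS]addr0 {1}Ei -[LHS]subr0 {1}Ej.
      by rewrite Mii Mjj Mij Mik Mji Mjk /g; ring.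
    by rewrite ab1 subrr mulr0.
  apply/eqP; rewrite -subr_eq0; move/eqP: key; rewrite mulf_eq0 => /orP[|//].
  by rewrite mulrn_eq0 !mulf_eq0 (negPf b_neq0) (gt_eqF a_gt0) (gt_eqF ab_gt0) (gt_eqF a2b_gt0).
have D0 i : D i = D 0 by have [->//|/Dij] := eqVneq i 0.
have Tii i : T i i * c = D 0.
  have [j ij] := ord3_neq i.
  have [k [ki kj S]] := ord3_sum C ij.
  rewrite Td S !D0 /sm eqxx (negPf ij) eq_sym (negPf ki) -[RHS]mul1r -ab1.
  by ring.
(* For constant [D] the right-hand sides are [D 0] times the square of [sm], with entries 1 and [g];
   cancelling [- 2 g] gives the off-diagonal ratio [- 1/2]. *)
move=> i j; apply: (mulIf c0); rewrite mulrAC Tii /trine_gram.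
have [->|ij] := eqVneq i j; first by rewrite Tii mulr1.
have [k [ki kj S]] := ord3_sum C ij.
apply: (mulIf g0); apply: (mulIf (_ : - 2 != 0 :> C)).
  by rewrite oppr_eq0 pnatr_eq0.
transitivity (T i j * (c * (- g *+ 2))); first by ring.
rewrite To // S !D0 /sm !eqxx (negPf ij) [j == i]eq_sym (negPf ij).
rewrite [i == k]eq_sym [j == k]eq_sym (negPf ki) (negPf kj) /g.
by field.
Qed.

End Rigidity.

(** * Excluding equality in the dual bound *)

Section NoEquality.
Variables (C : numClosedFieldType) (N : nat) (a b : C).
Hypotheses (a_real : a^* = a) (b_real : b^* = b).
Hypotheses (a_gt0 : 0 < a) (ab_gt0 : 0 < a - b) (a2b_gt0 : 0 < a + b *+ 2).
Hypotheses (b_neq0 : b != 0) (ab1 : a ^+ 2 + b ^+ 2 *+ 2 = 1).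
Hypothesis abN : a * b *+ 2 + b ^+ 2 = (- 2^-1) ^+ N.

Lemma sum_trine_gram i : \sum_j trine_gram C i j = 0.
Proof.
have [j ij] := ord3_neq i.
have [k [ki kj S]] := ord3_sum C ij.
by rewrite S /trine_gram eqxx (negPf ij) eq_sym (negPf ki); field.
Qed.

(** The sum has squared norm [c] times the sum of all entries of [trine_gram], whose rows sum to
    zero. *)
Lemma trine_sum0 (T : finType) (x : 'I_3 -> T -> C) (c : C) :
  (forall i j, dot (x i) (x j) = c * trine_gram C i j) ->
  forall s, \sum_j x j s = 0.
Proof.
move=> xg s; have : (fun s => \sum_j 1 * x j s) =1 fun=> 0.
  apply: dot_eq0; rewrite dot_sumr big1 // => j _.
  rewrite dot_suml; under eq_bigr do rewrite conjC1 mul1r -[dot _ _]conj_dot xg.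
  by rewrite -rmorph_sum -mulr_sumr sum_trine_gram mulr0 rmorph0 mulr0.
by move/(_ s); under eq_bigr do rewrite mul1r.
Qed.

Lemma trine_mulv_row0 (A : 'M[C]_2) (x : 'I_3 -> 'I_2 -> C) (c : C) :
  (forall i j, dot (x i) (x j) = c * trine_gram C i j) ->
  forall i, \sum_j dot (mulv A (x i)) (mulv A (x j)) = 0.
Proof.
move=> xg i; under eq_bigr do rewrite -[dot _ _]mul1r.
rewrite -dot_sumr [LHS]big1 // => s _; rewrite -[RHS](mulr0 (mulv A (x i) s)^*).
congr (_ * _); under eq_bigr do rewrite mul1r.
rewrite exchange_big big1 // => b' _.
by rewrite -mulr_sumr (trine_sum0 xg) mulr0.
Qed.

(** Induction on the tree. The invariant, a product form with each local Gram matrix a nonzero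
    multiple of the trine one, passes to some child of a node and is contradictory at a leaf. *)
Lemma guess_neq (p : protocol C N) (f : 'I_3 -> vec C N)
    (x : 'I_N -> 'I_3 -> 'I_2 -> C) (d : 'I_N -> C) :
  valid p -> (forall l, d l != 0) ->
  (forall l i j, dot (x l i) (x l j) = d l * trine_gram C i j) ->
  (forall i, comb a b f i =1 tensor (fun l => x l i)) ->
  guess a b p f <> lagrange a b f.
Proof.
elim: p f x d => [l|k m K next IH] f x d vp d0 xg fx eqf.
  have orth := guess_eq_orth a_real b_real a_gt0 ab_gt0 a2b_gt0 vp eqf.
  move: eqf; rewrite guess_leaf => /(lagrange_eq a_real b_real a_gt0 ab_gt0 a2b_gt0) f0.
  have [j lj] := ord3_neq l.
  (* Only [f l] survives, so the state vectors have squared norms [a^2] and [b^2] times its own. By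
     the invariant these are equal, and [a^2 != b^2] forces them to be zero. *)
  have dotE i : \prod_l d l = sm a b i l ^+ 2 * dot (f l) (f l).
    transitivity (dot (comb a b f i) (comb a b f i)).
      rewrite (eq_dot (fx i) (fx i)) dot_tensor; apply: eq_bigr => r _.
      by rewrite xg /trine_gram eqxx mulr1.
    rewrite (dot_comb_orth a_real b_real) // (bigD1 l) //= big1 ?addr0 // => r rl.
    by rewrite [dot _ _]big1 ?mulr0 // => s _; rewrite f0 ?mulr0.
  have fl : (a - b) * (a + (a + b *+ 2)) * dot (f l) (f l) = 0.
    pose D := dot (f l) (f l).
    transitivity ((sm a b l l ^+ 2 * D - sm a b j l ^+ 2 * D) *+ 2).
      by rewrite /sm eqxx eq_sym (negPf lj) -/D; ring.
    by rewrite -!dotE subrr mul0rn.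
  have /eqP : \prod_l d l = 0.
    move/eqP: fl; rewrite mulf_eq0 (gt_eqF (mulr_gt0 ab_gt0 (addr_gt0 a_gt0 a2b_gt0))) => /eqP fl.
    by rewrite (dotE l) fl mulr0.
  by apply/negP/prodf_neq0 => r _.
have [K1 vnext] := vp; set f' := fun j i => act k (K j) (f i).
have eqf' j : guess a b (next j) (f' j) = lagrange a b (f' j).
  exact: (guess_node_eq a_real b_real a_gt0 ab_gt0 a2b_gt0 vp eqf j).
pose x' j i := mulv (K j) (x k i).
pose T j i i' := dot (x' j i) (x' j i').
have sumT : \sum_j T j 0 0 = d k.
  by rewrite (sum_dot_mulv _ _ K1) xg /trine_gram eqxx mulr1.
(* The invariant needs a nonzero scale, so the induction follows an outcome whose weight does not
   vanish. *)
have [j Tj0] : exists j, T j 0 0 != 0.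
  apply/existsP; apply: contraNT (d0 k) => /existsPn T0.
  by rewrite -sumT big1 // => j _; apply/eqP; have := T0 j; rewrite negbK.
pose c := \prod_(l | l != k) d l.
have fx' i : comb a b (f' j) i =1
    tensor (fun l => if l == k then x' j i else x l i).
  move=> s; rewrite -act_tensor -(eq_act k (K j) (fx i)).
  by rewrite /comb act_sum.
have combE i i' : dot (comb a b (f' j) i) (comb a b (f' j) i') =
    T j i i' * (c * trine_gram C i i' ^+ N.-1).
  rewrite (eq_dot (fx' i) (fx' i')) dot_tensor (bigD1 k) //= eqxx; congr (_ * _).
  have -> : N.-1 = #|predC1 k| by rewrite cardC1 card_ord.
  rewrite -prodr_const -big_split.
  by apply: eq_bigr => l /negPf lk; rewrite lk xg.
have orth := guess_eq_orth a_real b_real a_gt0 ab_gt0 a2b_gt0 (vnext j) (eqf' j).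
have TE i i' : T j i i' = T j 0 0 * trine_gram C i i'.
  apply: (gram_rigidity (D := fun i => dot (f' j i) (f' j i)) a_gt0 ab_gt0
    a2b_gt0 b_neq0 ab1 (c := c)).
  - by apply/prodf_neq0 => l _.
  - exact: trine_mulv_row0 (xg k).
  - move=> r; rewrite -(dot_comb_orth a_real b_real) // combE /trine_gram eqxx.
    by rewrite expr1n mulr1.
  move=> r r' rr'; rewrite -(dot_comb_orth a_real b_real) // combE abN.
  rewrite /trine_gram (negPf rr'); congr (_ * (_ * _)).
  (* The other [N - 1] parties contribute [(- 1/2)^(N-1)], which is [- 2 g]; the party [k] witnesses
     [0 < N]. *)
  rewrite -[in LHS](prednK (leq_ltn_trans (leq0n k) (ltn_ord k))) exprS.
  by field.
apply: (IH j (f' j) (fun l i => if l == k then x' j i else x l i)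
  (fun l => if l == k then T j 0 0 else d l) (vnext j)) => //.
  by move=> l; case: ifP.
by move=> l i i'; case: ifP => _; [exact: TE | exact: xg].
Qed.

End NoEquality.

(** * Measuring in an orthonormal family *)

Section OrthonormalMeasurement.
Variables (C : numClosedFieldType) (N : nat) (phi : 'I_3 -> vec C N).
Hypothesis phi_on : forall i j, dot (phi i) (phi j) = (i == j)%:R.

(** Outcome 0 also receives the projector on the orthogonal complement of the family, which
    completes the measurement. *)
Definition frame_povm (i : 'I_3) : op C N := fun s t =>
  phi i s * (phi i t)^* +
  (i == 0)%:R * ((s == t)%:R - \sum_j phi j s * (phi j t)^*).

Lemma inner_op_frame i (v : vec C N) :
  inner_op v (frame_povm i) v =
  `|dot (phi i) v| ^+ 2 + (i == 0)%:R * (dot v v - \sum_j `|dot (phi j) v| ^+ 2).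
Proof.
have proj j : `|dot (phi j) v| ^+ 2 =
    \sum_s \sum_t (v s)^* * (phi j s * (phi j t)^*) * v t.
  rewrite normCK mulrC conj_dot mulr_suml; apply: eq_bigr => s _.
  by rewrite mulr_sumr; apply: eq_bigr => t _; ring.
have idv : dot v v = \sum_s \sum_t (v s)^* * (s == t)%:R * v t.
  apply: eq_bigr => s _; rewrite (bigD1 s) //= eqxx mulr1 big1 ?addr0 // => t /negPf ts.
  by rewrite eq_sym ts mulr0 mul0r.
rewrite idv (eq_bigr _ (fun j _ => proj j)) proj [X in _ - X]exchange_big.
rewrite -sumrB mulr_sumr -big_split; apply: eq_bigr => s _ /=.
rewrite [X in _ - X]exchange_big -sumrB mulr_sumr -big_split.
apply: eq_bigr => t _; rewrite /= /frame_povm -mulr_suml -mulr_sumr.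
by ring.
Qed.

Lemma bessel (v : vec C N) : \sum_j `|dot (phi j) v| ^+ 2 <= dot v v.
Proof.
have := dot_ge0 (fun s => v s - \sum_j dot (phi j) v * phi j s).
rewrite dotBB !dot_sumr !dot_suml.
have -> : \sum_i dot (phi i) v * dot v (phi i) = \sum_j `|dot (phi j) v| ^+ 2.
  by apply: eq_bigr => j _; rewrite normCK conj_dot.
have -> : \sum_i (dot (phi i) v)^* * dot (phi i) v = \sum_j `|dot (phi j) v| ^+ 2.
  by apply: eq_bigr => j _; rewrite normCK mulrC.
under eq_bigr => i _.
  rewrite dot_suml (bigD1 i) //= phi_on eqxx mulr1 big1 ?addr0 => [|j /negPf ji].
    rewrite -normCK; over.
  by rewrite phi_on ji mulr0.
by rewrite opprD addrA addrK subr_ge0.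
Qed.

Lemma frame_povmP : povm frame_povm.
Proof.
split=> [i v|s t].
  rewrite inner_op_frame addr_ge0 ?exprn_ge0 // mulr_ge0 ?ler0n //.
  by rewrite subr_ge0 bessel.
have d1 : \sum_(i < 3) (i == 0)%:R = 1 :> C.
  by rewrite (bigD1 0) //= big1 ?addr0 // => i /negPf ->.
by rewrite big_split -mulr_suml /= d1 mul1r addrC subrK; case: eqP.
Qed.

Lemma inner_op_frame_ge i (v : vec C N) :
  `|dot (phi i) v| ^+ 2 <= inner_op v (frame_povm i) v.
Proof.
by rewrite inner_op_frame lerDl mulr_ge0 ?ler0n // subr_ge0 bessel.
Qed.

End OrthonormalMeasurement.

(** * Recovering the orthonormal basis from the states *)

Section SquareRoot.
Variables (C : numClosedFieldType) (a b : C).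
Hypotheses (a_real : a^* = a) (b_real : b^* = b).
Hypotheses (ab_gt0 : 0 < a - b) (a2b_gt0 : 0 < a + b *+ 2).
Variables (T : finType) (f : 'I_3 -> T -> C).

Let e := (a - b) * (a + b *+ 2).

(** The coefficients are the entries of the inverse of the circulant matrix [sm], whose eigenvalues
    are [a - b] (twice) and [a + b *+ 2]. *)
Definition uncomb : 'I_3 -> T -> C := comb ((a + b) / e) (- b / e) f.

Lemma combK i : comb a b uncomb i =1 f i.
Proof.
move=> s; have [j ij] := ord3_neq i.
have [k [ki kj S]] := ord3_sum C ij.
rewrite /comb /uncomb /comb !S /sm !eqxx.
rewrite [j == i]eq_sym [i == k]eq_sym [j == k]eq_sym.
rewrite (negPf ij) (negPf ki) (negPf kj) /e.
by field; rewrite mulr_natr (gt_eqF a2b_gt0) (gt_eqF ab_gt0).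
Qed.

Lemma dot_uncomb :
  (forall i j, dot (f i) (f j) =
     if i == j then a ^+ 2 + b ^+ 2 *+ 2 else a * b *+ 2 + b ^+ 2) ->
  forall i j, dot (uncomb i) (uncomb j) = (i == j)%:R.
Proof.
move=> fg i j.
have e_real : e^* = e.
  by rewrite /e !(rmorphM, rmorphB, rmorphD, rmorphMn) /= a_real b_real.
have E : forall i j, i != j -> dot (uncomb i) (uncomb i) = 1 /\ dot (uncomb i) (uncomb j) = 0.
  move=> {}i {}j ij; have [k [ki kj S]] := ord3_sum C ij.
  rewrite !dot_comb ?(rmorphM, rmorphB, rmorphD, rmorphN, fmorphV) /= ?e_real ?a_real ?b_real //.
  rewrite !S !fg /sm !eqxx [j == i]eq_sym [i == k]eq_sym [j == k]eq_sym.
  rewrite (negPf ij) (negPf ki) (negPf kj) /e.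
  by split; field; rewrite mulr_natr (gt_eqF a2b_gt0) (gt_eqF ab_gt0).
have [<-|/E[]//] := eqVneq i j.
by have [r /E[]] := ord3_neq i.
Qed.

End SquareRoot.

(** * The ensemble as powers of trine vectors *)

Section Trine.
Variables (C : numClosedFieldType) (N : nat).

(** The signed rotation [- rot60] turns by 240 degrees; these are the images of the first basis
    vector under its powers. *)
Definition trine (i : 'I_3) : 'I_2 -> C := fun c =>
  if i == 0 then (c == 0)%:R else
  if c == 0 then - 2^-1 else (-1) ^+ i * (sqrtC 3 / 2).

Lemma dot_trine i j : dot (trine i) (trine j) = trine_gram C i j.
Proof.
have r3 : (sqrtC 3 : C)^* = sqrtC 3 by apply/conj_Creal/ger0_real; rewrite sqrtC_ge0 ler0n.
have q3 : (sqrtC 3 : C) ^+ 2 = 3 by rewrite sqrtCK.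
have half : (2^-1 : C)^* = 2^-1 by rewrite fmorphV rmorph_nat.
have real i' c : (trine i' c)^* = trine i' c.
  rewrite /trine; case: ifP => _; first by rewrite rmorph_nat.
  by case: ifP => _; rewrite !(rmorphN, rmorphM, rmorphXn, rmorph1) /= half ?r3.
rewrite /dot !big_ord_recl big_ord0 !real /trine /trine_gram.
move: i j; do 2![case=> [[|[|[|//]]] ?]] => /=; rewrite -?val_eqE /= ?expr1 ?expr2.
all: try by field.
all: by field: q3.
Qed.

Definition rot60 : 'M[C]_2 :=
  \matrix_(a < 2, b < 2)
     (if (a == 0) && (b == 0) then 2^-1
      else if (a == 0) then - (sqrtC 3 / 2)
      else if (b == 0) then sqrtC 3 / 2 else 2^-1).

Lemma trineE (i : 'I_3) (c : 'I_2) : (-1) ^+ i * (rot60 ^+ i *m ket0 C) c 0 = trine i c.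
Proof.
have q3 : (sqrtC 3 : C) ^+ 2 = 3 by rewrite sqrtCK.
have k0 (A : 'M[C]_2) : (A *m ket0 C) c 0 = A c 0.
  rewrite mxE (bigD1 0) //= big1 ?addr0 ?mxE ?mulr1 // => b' /negPf b0.
  by rewrite mxE b0 mulr0.
rewrite k0 /trine.
case: i => [[|[|[|//]]] ?]; case: c {k0} => [[|[|//]] ?] /=.
all: rewrite -?val_eqE /= ?expr0 ?expr1 ?expr2 !mxE ?big_ord_recl ?big_ord0 ?mxE -?val_eqE /=.
all: by field: q3.
Qed.

Lemma omegaN : (0 < N)%N -> omega C N ^+ N = 1.
Proof. by move=> N0; rewrite /omega exprAC rootCK // sqrrN expr1n. Qed.

(** Each qubit carries the phase [omega ^+ i]; over all [N] qubits these multiply to 1, while the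
    sign is absorbed in [trine]. *)
Lemma psi_trine : (0 < N)%N ->
  forall i, psi C (N := N) i =1 tensor (fun=> trine i).
Proof.
move=> N0 i s; rewrite /psi /tensor.
have UE : Umat C N ^+ i *m ket0 C =
    (- omega C N) ^+ i *: (rot60 ^+ i *m ket0 C).
  by rewrite [Umat C N ^+ i](exprZn _ rot60); apply/esym/scalemxAl.
rewrite UE; under [LHS]eq_bigr do rewrite mxE exprNn -mulrA mulrCA trineE.
by rewrite big_split /= prodr_const card_ord exprAC omegaN // expr1n mul1r.
Qed.

End Trine.

(** The Gram matrix has eigenvalues [1 + 2 g] and [1 - g] (twice), positive once [|g| <= 1/4]. Its
    positive root has [b != 0] because [g != 0]. *)
Lemma sqrt_gram_coefs (C : numClosedFieldType) (N : nat) : (2 <= N)%N ->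
  exists a b : C, [/\ [/\ a^* = a, b^* = b & b != 0],
    [/\ 0 < a, 0 < a - b & 0 < a + b *+ 2],
    a ^+ 2 + b ^+ 2 *+ 2 = 1 & a * b *+ 2 + b ^+ 2 = (- 2^-1) ^+ N].
Proof.
case: N => [|[|n]] // _; set g : C := _ ^+ n.+2.
pose t : C := (- 2^-1) ^+ n.
have gE : g = t / 4 by rewrite /g /t !exprS; field.
have t_real : t \is Num.real by rewrite rpredX // rpredN rpredV realn.
have : `|t| <= 1.
  by rewrite normrX normrN exprn_ile1 ?normr_ge0 // ger0_norm ?invf_le1 ?ler1n ?invr_ge0 ?ler0n // ltr0n.
rewrite real_ler_norml // => /andP[tge tle].
have w0 : 0 < 1 - g.
  have -> : 1 - g = (3 + (1 - t)) / 4 by rewrite gE; field.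
  by rewrite divr_gt0 ?ltr0n // ltr_wpDr ?subr_ge0 ?ltr0n.
have u0 : 0 < 1 + g *+ 2.
  have -> : 1 + g *+ 2 = (1 + (t - (- 1))) / 2 by rewrite gE; field.
  by rewrite divr_gt0 ?ltr0n // ltr_wpDr ?subr_ge0 ?ltr01.
pose u := sqrtC (1 + g *+ 2); pose w := sqrtC (1 - g).
have uK : u ^+ 2 = 1 + g *+ 2 by rewrite sqrtCK.
have wK : w ^+ 2 = 1 - g by rewrite sqrtCK.
have {}u0 : 0 < u by rewrite sqrtC_gt0.
have {}w0 : 0 < w by rewrite sqrtC_gt0.
(* The solution of [a + b *+ 2 = u] and [a - b = w], the eigenvalues of the root. *)
exists ((u + w *+ 2) / 3), ((u - w) / 3).
have ur : u^* = u by apply/conj_Creal/gtr0_real.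
have wr : w^* = w by apply/conj_Creal/gtr0_real.
have r3 : (3^-1 : C)^* = 3^-1 by rewrite fmorphV rmorph_nat.
split; last 2 first.
- by field: uK wK.
- by field: uK wK.
- split; rewrite ?(rmorphM, rmorphB, rmorphD, rmorphMn) /= ?r3 ?ur ?wr //.
  rewrite mulf_neq0 ?invr_neq0 ?pnatr_eq0 // subr_eq0; apply/eqP => uw.
  have : g *+ 3 = 0 by rewrite -[LHS](addrK (1 - g)) -{2}wK -uw uK; ring.
  move/eqP; rewrite mulrn_eq0 expf_eq0 /= oppr_eq0 invr_eq0 pnatr_eq0.
  by [].
split.
- by rewrite divr_gt0 ?ltr0n // addr_gt0 ?pmulrn_lgt0.
- by have -> : (u + w *+ 2) / 3 - (u - w) / 3 = w by field.
by have -> : (u + w *+ 2) / 3 + ((u - w) / 3) *+ 2 = u by field.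
Qed.

Theorem theorem3 (C : numClosedFieldType) (N : nat) (hN : (2 <= N)%N)
  (p : protocol C N) (hp : valid p) :
  exists Pi : 'I_3 -> op C N, povm Pi /\ locc_success p < success Pi.
Proof.
have N0 : (0 < N)%N by apply: ltnW.
have [a [b [[a_real b_real b0] [a_gt0 ab_gt0 a2b_gt0] ab1 abN]]] := sqrt_gram_coefs C hN.
pose phi := uncomb a b (psi C (N := N)).
have psiE i : comb a b phi i =1 psi C (N := N) i by apply: combK.
have phi_on i j : dot (phi i) (phi j) = (i == j)%:R.
  apply: dot_uncomb => // {}i {}j; rewrite abN ab1.
  rewrite (eq_dot (psi_trine C N0 i) (psi_trine C N0 j)) dot_tensor.
  under eq_bigr do rewrite dot_trine.
  by rewrite prodr_const card_ord /trine_gram; case: eqP => // _; rewrite expr1n.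
exists (frame_povm phi); split; first exact: frame_povmP.
have lag : lagrange a b phi = 3 * a ^+ 2.
  rewrite /lagrange !big_ord_recl !big_ord0 !phi_on /sm /=.
  by ring.
(* The value [a ^+ 2] separates the two: the protocol stays strictly below it by [guess_le] and
   [guess_neq], and [frame_povm phi] reaches it since [phi i] and [psi i] have overlap [a]. *)
apply: (@lt_le_trans _ _ (a ^+ 2)).
  have -> : locc_success p = 3^-1 * guess a b p phi.
    rewrite /locc_success -mulr_sumr; congr (_ * _).
    by apply: eq_bigr => i _; apply: eq_prob => s; rewrite psiE.
  rewrite -ltr_pdivlMl ?invr_gt0 ?ltr0n // invrK -lag lt_neqAle guess_le // andbT.
  apply/eqP; apply: (guess_neq a_real b_real a_gt0 ab_gt0 a2b_gt0 b0 ab1 abN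
    (x := fun _ i => trine C i) (d := fun=> 1)) => //.
  - by move=> l; rewrite oner_eq0.
  - by move=> l i j; rewrite mul1r dot_trine.
  by move=> i s; rewrite psiE psi_trine.
have -> : a ^+ 2 = \sum_(i < 3) 3^-1 * a ^+ 2.
  by rewrite !big_ord_recl big_ord0; field.
apply: ler_sum => i _; rewrite ler_pM2l ?invr_gt0 ?ltr0n //.
apply: le_trans (inner_op_frame_ge phi_on i (psi C (N := N) i)).
have -> : dot (phi i) (psi C (N := N) i) = a.
  rewrite -(eq_dot (fun=> erefl) (psiE i)) dot_sumr (bigD1 i) //= big1 ?addr0.
    by rewrite phi_on eqxx mulr1 /sm eqxx.
  by move=> j ji; rewrite phi_on eq_sym (negPf ji) mulr0.
by rewrite ger0_norm // ltW.
Qed.
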